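(* Let $A(n,k)$ denote the Eulerian numbers. Then $$\sum_{n\ge0}A(2n,n+1)z^n=14+3\left(3z^2-4z+2\right)\Psi(z)+\left(21z^3+20z^2+13z+23\right)\Psi^3(z)+3\left(6z^4+4z^3+3z^2+4\right)\Psi^5(z)\quad\text{modulo }27.$$
   Context: $A(n,k)$ is the number of permutations of $\{1,\dots,n\}$ with exactly $k-1$ descents; equivalently $A(n,k)=\sum_{j=0}^{k}(-1)^{k-j}\binom{n+1}{k-j}j^n$ (with $A(0,1)=1$). $\Psi(z)=\prod_{j\ge0}(1+z^{3^j})$. ''Modulo $27$'' means all coefficients of the difference of the two power series in $z$ are divisible by $27$. *)

(* Defs.v *)
From HB Require Import structures.
From mathcomp Require Import all_boot all_order all_algebra.
Set Implicit Arguments. Unset Strict Implicit. Unset Printing Implicit Defensive.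
Import Order.TTheory GRing.Theory Num.Theory.
Local Open Scope ring_scope.

(* Eulerian number A(n,k): A(0,k) = [k = 1] (the empty permutation has 0 descents);
   for n >= 1, A(n,k) = sum_{j=0}^{k} (-1)^(k-j) C(n+1,k-j) j^n. *)
Definition eulerian (n k : nat) : int :=
  if n is 0 then ((k == 1%N) : nat)%:Z
  else \sum_(0 <= j < k.+1)
         (-1) ^+ (k - j) * ('C(n.+1, k - j))%:Z * ((j ^ n)%N)%:Z.

(* Truncation of Psi(z) = prod_{j>=0} (1 + z^(3^j)): the factors with j > N
   are 1 + O(z^(N+1)), so this polynomial agrees with Psi up to degree N. *)
Definition Psi_trunc (N : nat) : {poly int} :=
  \prod_(j < N.+1) (1 + 'X^(3 ^ j)).

(* The right-hand side, with Psi replaced by its truncation at order N;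
   its coefficients of degree <= N equal those of the power series. *)
Definition rhs_trunc (N : nat) : {poly int} :=
  let P := Psi_trunc N in
  14%:P
  + 3%:P * (3%:P * 'X^2 - 4%:P * 'X + 2%:P) * P
  + (21%:P * 'X^3 + 20%:P * 'X^2 + 13%:P * 'X + 23%:P) * P ^+ 3
  + 3%:P * (6%:P * 'X^4 + 4%:P * 'X^3 + 3%:P * 'X^2 + 4%:P) * P ^+ 5.

(* Main.v *)
(* For n >= 1, A(2n,n+1) = sum_j w_n(j) j^(2n), where w_n(j) = (-1)^(n+j-1) C(2n+1,n+j) is the
   coefficient of Y^j in (Y-1)^(2n+1) / Y^n.  Modulo 27 and for n >= 2, j^(2n) is 0 when 3 | j and
   1 + n(j^2-1) + C(n,2)(j^2-1)^2 otherwise.  Multiplying by (Y-1)^2/Y turns sums of f against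
   w_(n+1) into sums of the second difference of f against w_n, so the weighted sums of 1, j^2,
   j^4, [3 does not divide j] and [3 | j] (j/3)^2 obey short recurrences.  The outcome is
     A(2n,n+1) = s_n + 12 c_(n-2) mod 27,   c_n = (-1)^n C(2n,n),   s_n = (-1)^(n-1) Cat(n-1),
   that is, the generating function is 14 + (14(1+4z) + 12z^2) D with D = (1+4z)^(-1/2).
   On the other side (1+z) Psi^2 = 1 mod 3, so Psi = D + 3u.  Substituting this in the right-hand
   side, the terms linear in u carry the factor 9(a + b D^2 + 5c D^4), where a, b, c are the
   coefficients of 3 Psi, Psi^3 and 3 Psi^5; that factor vanishes mod 27 because (1+4z) D^2 = 1,
   and what remains is the same expression in D. *)
Require Import Defs.
From HB Require Import structures.
From mathcomp Require Import all_boot all_order all_algebra.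
From mathcomp Require Import ring zify.
Import GRing.Theory.
Local Open Scope ring_scope.
Set Implicit Arguments. Unset Strict Implicit. Unset Printing Implicit Defensive.

(** * Weighted sums and second differences *)

(* The weight w_n(i+1). *)
Definition wt (n i : nat) : int := (-1) ^+ (n + i) * ('C((2 * n).+1, (n + i).+1))%:Z.

Definition wsum (n : nat) (f : nat -> int) : int :=
  \sum_(i < n.+1) wt n i * f i.+1.

Definition diff2 (f : nat -> int) (j : nat) : int := f j.+1 - 2 * f j + f j.-1.

Definition cbin (n : nat) : int := (-1) ^+ n * ('C(2 * n, n))%:Z.

Definition sqsum (n : nat) : int := wsum n (fun j => j%:Z ^+ 2).

Lemma wt_small n i : (n < i)%N -> wt n i = 0.
Proof. by move=> lt_ni; rewrite /wt bin_small ?mulr0 //; lia. Qed.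

Lemma wsum_widen n K f : (n < K)%N -> wsum n f = \sum_(i < K) wt n i * f i.+1.
Proof.
move=> lt_nK; rewrite /wsum (big_ord_widen K (fun i => wt n i * f i.+1)) //.
rewrite big_mkcond /=; apply: eq_bigr => i _; case: ltnP => // le_ni.
by rewrite wt_small ?mul0r.
Qed.

Lemma bin_add2 N k : 'C(N.+2, k.+2) = ('C(N, k.+2) + 2 * 'C(N, k.+1) + 'C(N, k))%N.
Proof. rewrite !binS; lia. Qed.

(** The recurrence [wtSS] at i = -1: the missing weight w_n(0) is - w_n(1), so the coefficient -2
    becomes -3. *)
Lemma wt0S n : wt n.+1 0 = wt n 1 - 3 * wt n 0.
Proof.
rewrite /wt !addn0 addn1 mulnS add2n bin_add2 !exprS.
have -> : 'C((2 * n).+1, n) = 'C((2 * n).+1, n.+1).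
  by rewrite -bin_sub; [congr 'C(_, _); lia | lia].
ring.
Qed.

Lemma wtSS n i : wt n.+1 i.+1 = wt n i - 2 * wt n i.+1 + wt n i.+2.
Proof.
rewrite /wt mulnS add2n addSn !addnS bin_add2 !exprS; ring.
Qed.

(* The boundary term comes from w_n(0) = - w_n(1). *)
Lemma wsumS n f : wsum n.+1 f = wsum n (diff2 f) - wt n 0 * (f 0%N + f 1%N).
Proof.
(* A common range with vanishing top weights leaves boundary terms only at the bottom. *)
rewrite (@wsum_widen n.+1 n.+3) // (@wsum_widen n n.+3) ?ltnS ?leqW //.
rewrite big_ord_recl wt0S.
under eq_bigr => i _ do rewrite lift0 wtSS.
rewrite /diff2.
have -> : \sum_(i < n.+2) (wt n i - 2 * wt n i.+1 + wt n i.+2) * f i.+2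
  = \sum_(i < n.+2) wt n i * f i.+2 - 2 * (\sum_(i < n.+2) wt n i.+1 * f i.+2)
   + \sum_(i < n.+2) wt n i.+2 * f i.+2.
  rewrite mulr_sumr -sumrB -big_split; apply: eq_bigr => i _ /=; ring.
have -> : \sum_(i < n.+3) wt n i * (f i.+2 - 2 * f i.+1 + f i.+1.-1)
  = \sum_(i < n.+3) wt n i * f i.+2 - 2 * (\sum_(i < n.+3) wt n i * f i.+1)
   + \sum_(i < n.+3) wt n i * f i.
  rewrite mulr_sumr -sumrB -big_split; apply: eq_bigr => i _ /=; ring.
have -> : \sum_(i < n.+3) wt n i * f i.+2 = \sum_(i < n.+2) wt n i * f i.+2.
  by rewrite big_ord_recr /= (wt_small (ltnW (ltnSn n.+1))) mul0r addr0.
have -> : \sum_(i < n.+3) wt n i * f i.+1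
    = wt n 0 * f 1%N + \sum_(i < n.+2) wt n i.+1 * f i.+2.
  by rewrite big_ord_recl.
have -> : \sum_(i < n.+3) wt n i * f i
    = wt n 0 * f 0%N + wt n 1 * f 1%N + \sum_(i < n.+2) wt n i.+2 * f i.+2.
  rewrite big_ord_recl big_ord_recl addrA; congr (_ + _).
  by rewrite [RHS]big_ord_recr /= (@wt_small n n.+3) ?mul0r ?addr0 // ltnW // ltnW.
ring.
Qed.

Lemma eq_wsum n f g : (forall i, f i.+1 = g i.+1) -> wsum n f = wsum n g.
Proof. by move=> fg; apply: eq_bigr => i _; rewrite fg. Qed.

Lemma wsumD n f g : wsum n (fun j => f j + g j) = wsum n f + wsum n g.
Proof. by rewrite -big_split; apply: eq_bigr => i _; rewrite mulrDr. Qed.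

Lemma wsumZ n a f : wsum n (fun j => a * f j) = a * wsum n f.
Proof. by rewrite mulr_sumr; apply: eq_bigr => i _; rewrite mulrCA. Qed.

Lemma dvd_wsum n (m : int) f : (forall i, (m %| f i.+1)%Z) -> (m %| wsum n f)%Z.
Proof. by move=> mf; apply: rpred_sum => i _; apply: dvdz_mull. Qed.

(** * Moments of the weights: central binomials and Catalan numbers *)

Lemma cbinS n : cbin n.+1 = - 2 * wt n 0.
Proof.
rewrite /cbin /wt addn0 mulnS add2n binS exprS.
have -> : 'C((2 * n).+1, n) = 'C((2 * n).+1, n.+1).
  by rewrite -bin_sub; [congr 'C(_, _); lia | lia].
ring.
Qed.

Lemma wsum1 n : wsum n (fun=> 1) = cbin n.
Proof.
case: n => [|n]; first by rewrite /wsum big_ord1.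
rewrite wsumS cbinS (@eq_wsum _ _ (fun=> 0 * 1)); last by [].
rewrite wsumZ; ring.
Qed.

Lemma sqsumS n : sqsum n.+1 = 2 * cbin n - wt n 0.
Proof.
rewrite /sqsum wsumS (@eq_wsum _ _ (fun=> 2 * 1)) ?wsumZ ?wsum1; last first.
  by move=> i; rewrite /diff2 /= -!natz; ring.
ring.
Qed.

Lemma double_sqsumS n : 2 * sqsum n.+1 = cbin n.+1 + 4 * cbin n.
Proof. rewrite sqsumS cbinS; ring. Qed.

(** Coefficient form of (1+4z) D' = -2 D for D = (1+4z)^(-1/2). *)
Lemma cbin_rec n : n.+1%:Z * cbin n.+1 = - 2 * (2 * n%:Z + 1) * cbin n.
Proof.
rewrite cbinS /wt /cbin addn0.
have /(congr1 Posz) := mul_bin_diag (2 * n).+1 n; rewrite !PoszM /= => e.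
transitivity (- 2 * (-1) ^+ n * (n.+1%:Z * 'C((2 * n).+1, n.+1)%:Z)); first by ring.
rewrite -e -!natz; ring.
Qed.

(** Division-free form of [sqsum n.+1] = (-1)^n Cat(n). *)
Lemma sqsum_cbin n : n.+1%:Z * sqsum n.+1 = cbin n.
Proof.
have e1 := double_sqsumS n; have e2 := cbin_rec n.
have : 2 * (n.+1%:Z * sqsum n.+1) = 2 * cbin n.
  transitivity (n.+1%:Z * (2 * sqsum n.+1)); first by ring.
  rewrite e1 mulrDr e2 -!natz; ring.
lia.
Qed.

Lemma sqsumS_rec n : n.+2%:Z * sqsum n.+2 = - (4 * n%:Z + 2) * sqsum n.+1.
Proof.
have e1 := double_sqsumS n; rewrite sqsum_cbin.
have -> : cbin n.+1 = 2 * sqsum n.+1 - 4 * (n.+1%:Z * sqsum n.+1).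
  by rewrite e1 sqsum_cbin; ring.
rewrite -!natz; ring.
Qed.

Lemma wsum_pow4 n : wsum n.+1 (fun j => j%:Z ^+ 4) = sqsum n.+1 + 12 * sqsum n.
Proof.
rewrite wsumS (@eq_wsum _ _ (fun j => 12 * j%:Z ^+ 2 + 2 * 1)).
  rewrite wsumD !wsumZ wsum1 sqsumS /sqsum; ring.
by move=> i; rewrite /diff2 /= -!natz; ring.
Qed.

(** * Periodic functions and their weighted sums *)

Definition periodic (s : seq int) (j : nat) : int := s`_(j %% size s).

Lemma periodic_ind (P : nat -> Prop) (m : nat) : (0 < m)%N ->
  (forall i, P i -> P (i + m)%N) -> (forall r, (r < m)%N -> P r) -> forall i, P i.
Proof.
move=> m_gt0 Pm P0 i; rewrite (divn_eq i m) addnC.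
elim: (i %/ m)%N => [|q IHq]; first by apply: P0; rewrite mul0n addn0 ltn_mod.
by rewrite mulSn addnCA addnC; apply: Pm.
Qed.

Lemma periodicD s j : periodic s (j + size s) = periodic s j.
Proof. by rewrite /periodic modnDr. Qed.

(** Only positive arguments are covered: [0.-1 = 0] spoils periodicity at 0. *)
Lemma diff2_periodicD s i :
  diff2 (periodic s) (i.+1 + size s) = diff2 (periodic s) i.+1.
Proof. by rewrite /diff2 addSn /= -!addSn !periodicD. Qed.

Definition chi := periodic [:: 0; 1; 1].
(* Modulo 3, [tau j] is (j/3)^2 when 3 | j, and 0 otherwise; [tau1] and [tau2] are its first
   two iterated second differences. *)
Definition tau := periodic [:: 0; 0; 0; 1; 0; 0; 1; 0; 0].
Definition tau1 := periodic [:: 0; 0; 1; 1; 1; 1; 1; 1; 0].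
Definition tau2 := periodic [:: 0; 1; 2; 0; 0; 0; 0; 2; 1].

Lemma chiD j : chi (j + 3) = chi j. Proof. exact: periodicD. Qed.
Lemma tauD j : tau (j + 9) = tau j. Proof. exact: periodicD. Qed.
Lemma tau1D j : tau1 (j + 9) = tau1 j. Proof. exact: periodicD. Qed.
Lemma tau2D j : tau2 (j + 9) = tau2 j. Proof. exact: periodicD. Qed.

(** Any three consecutive values of [chi] add up to 2. *)
Lemma diff2_chi i : diff2 chi i.+1 = 2 - 3 * chi i.+1.
Proof.
move: i; apply: (@periodic_ind _ 3) => // [i|].
  by rewrite -addSn (diff2_periodicD [:: 0; 1; 1]) chiD.
by do 3?[case=> //].
Qed.

Lemma chi2 i : (3 %| (i%:Z ^+ 2 - chi i))%Z.
Proof.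
move: i; apply: (@periodic_ind _ 3) => // [i|].
  rewrite chiD => /dvdzP[q e].
  apply/dvdzP; exists (q + 2 * i%:Z + 3).
  rewrite -[chi i](subKr (i%:Z ^+ 2)) e; ring.
by do 3?[case=> //].
Qed.

(** The constant 2 and the boundary value 0 + 1 are those of j^2. Each iteration gains a factor 3,
    so three of them settle the sum modulo 27. *)
Lemma wsum_chiS n : wsum n.+1 chi = sqsum n.+1 - 3 * wsum n chi.
Proof.
rewrite wsumS (@eq_wsum _ _ (fun j => 2 * 1 + (- 3) * chi j)); last first.
  by move=> i; rewrite diff2_chi; ring.
by rewrite wsumD !wsumZ wsum1 sqsumS /=; ring.
Qed.

Lemma wsum_chi_mod3 n : (3 %| wsum n chi - sqsum n)%Z.
Proof.
case: n => [|n]; first by rewrite /sqsum /wsum !big_ord1.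
by apply/dvdzP; exists (- wsum n chi); rewrite wsum_chiS; ring.
Qed.


Lemma wsumS_cong (m : int) n f g :
  (forall i, (m %| diff2 f i.+1 - g i.+1)%Z) ->
  (m %| wsum n.+1 f - (wsum n g - wt n 0 * (f 0%N + f 1%N)))%Z.
Proof.
move=> fg; rewrite wsumS.
have -> : wsum n (diff2 f) - wt n 0 * (f 0%N + f 1%N)
    - (wsum n g - wt n 0 * (f 0%N + f 1%N))
   = wsum n (fun j => diff2 f j + (- 1) * g j) by rewrite wsumD wsumZ; ring.
by apply: dvd_wsum => i; rewrite mulN1r.
Qed.

(** Modulo 3, three second differences turn [tau] into 2 - 2 [chi]. Only the last boundary term is
    nonzero; with 2 [cbin n] it forms [sqsum n.+1]. *)
Lemma wsum_tau n : (3 %| wsum n.+3 tau - (sqsum n.+1 + sqsum n))%Z.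
Proof.
have h0 : (3 %| wsum n.+3 tau - (wsum n.+2 tau1 - wt n.+2 0 * (0 + 0)))%Z.
  apply: wsumS_cong; apply: (@periodic_ind _ 9) => // [i|].
    by rewrite -addSn (diff2_periodicD [:: 0; 0; 0; 1; 0; 0; 1; 0; 0]) tau1D.
  by do 9?[case=> //].
have h1 : (3 %| wsum n.+2 tau1 - (wsum n.+1 tau2 - wt n.+1 0 * (0 + 0)))%Z.
  apply: wsumS_cong; apply: (@periodic_ind _ 9) => // [i|].
    by rewrite -addSn (diff2_periodicD [:: 0; 0; 1; 1; 1; 1; 1; 1; 0]) tau2D.
  by do 9?[case=> //].
pose g j := 2 * 1 + (- 2) * chi j.
have h2 : (3 %| wsum n.+1 tau2 - (wsum n g - wt n 0 * (0 + 1)))%Z.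
  apply: wsumS_cong; apply: (@periodic_ind _ 9) => // [i|].
    rewrite -addSn (diff2_periodicD [:: 0; 1; 2; 0; 0; 0; 0; 2; 1]) /g.
    by rewrite (addnA _ 6 3) (addnA _ 3 3) !chiD.
  by do 9?[case=> //].
have h3 := wsum_chi_mod3 n.
move: h2; rewrite /g wsumD !wsumZ wsum1 => h2.
rewrite sqsumS; lia.
Qed.

(** * Eulerian numbers modulo 27 *)

Lemma eulerian_wsum n : eulerian (2 * n.+1) n.+2 = wsum n.+1 (fun j => j%:Z ^+ (2 * n.+1)).
Proof.
rewrite /eulerian mulnS add2n big_mkord big_ord_recl exp0n // mulr0 add0r.
apply: eq_bigr => i _; rewrite lift0 /wt mulnS add2n -!natz natrX.
have lt_i := ltn_ord i; congr (_ * _ * _).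
  by rewrite -signr_odd -[RHS]signr_odd; congr (_ ^+ _); congr nat_of_bool; lia.
congr (_%:R); rewrite -[RHS]bin_sub; [congr 'C(_, _)|]; lia.
Qed.

(** The binomial expansion stops at x^2; each induction step adds the error C(n,2) x^3. *)
Lemma expr1D_mod (x : int) n : (27 %| x ^+ 3)%Z ->
  (27 %| (1 + x) ^+ n - (1 + n%:Z * x + 'C(n, 2)%:Z * x ^+ 2))%Z.
Proof.
move=> /dvdzP[y xy]; elim: n => [|n /dvdzP[q e]].
  by rewrite bin0n expr0 !mul0r !addr0 subrr dvdz0.
apply/dvdzP; exists ((1 + x) * q + 'C(n, 2)%:Z * y).
transitivity ((1 + x) * ((1 + x) ^+ n - (1 + n%:Z * x + 'C(n, 2)%:Z * x ^+ 2))
  + 'C(n, 2)%:Z * x ^+ 3); last by rewrite e xy; ring.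
rewrite binS bin1 exprS -!natz; ring.
Qed.

(** If 3 does not divide j, this is [expr1D_mod] at x = j^2 - 1. If 3 divides j, then j^2 = 9
    [tau j] and j^4 = 0 mod 27, so the [tau] terms cancel both brackets. *)
Lemma pow_mod27 n j : (2 <= n)%N ->
  (27 %| j%:Z ^+ (2 * n) - (chi j + n%:Z * (j%:Z ^+ 2 - chi j - 9 * tau j)
     + 'C(n, 2)%:Z * (j%:Z ^+ 4 - 2 * j%:Z ^+ 2 + chi j + 18 * tau j)))%Z.
Proof.
move=> n_ge2.
have [d3|nd3] := boolP (3 %| j)%N.
  have chij : chi j = 0 by move: d3; rewrite /chi /periodic /= /dvdn => /eqP ->.
  have [t et] : exists t, j%:Z ^+ 2 = 9 * tau j + 27 * t.
    have [t et] : exists t, j%:Z ^+ 2 - 9 * tau j = t * 27.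
      apply/dvdzP; move: j d3 {chij}.
      apply: (@periodic_ind (fun j => (3 %| j)%N -> _) 9) => // [i IH|].
        rewrite dvdn_addl // tauD => /[dup] d3 /IH; case/dvdnP: d3 => k ->.
        (* (3k+9)^2 - (3k)^2 = 27 (2k+3). *)
        move=> /dvdzP[q e]; apply/dvdzP; exists (q + 2 * k%:Z + 3).
        rewrite !mulrDl -e; ring.
      by do 9?[case=> //].
    by exists t; lia.
  case: n n_ge2 => [|[|n]] // _; apply/dvdzP.
  exists (3 * (j%:Z ^+ 2 %/ 9)%Z ^+ 2 * j%:Z ^+ (2 * n) - n.+2%:Z * t
    - 'C(n.+2, 2)%:Z * (3 * (tau j + 3 * t) ^+ 2 - 2 * t)).
  have e4 : j%:Z ^+ (2 * n.+2) = (j%:Z ^+ 2) ^+ 2 * j%:Z ^+ (2 * n).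
    by rewrite -exprM -exprD; congr (_ ^+ _); lia.
  have -> : (j%:Z ^+ 2 %/ 9)%Z = tau j + 3 * t.
    have -> : j%:Z ^+ 2 = (tau j + 3 * t) * 9 by rewrite et; ring.
    by rewrite mulzK.
  have -> : j%:Z ^+ 4 = (j%:Z ^+ 2) ^+ 2 by rewrite -exprM.
  rewrite e4 chij et; move: (_ ^+ (2 * n)) => J; ring.
have -> : chi j = 1.
  move: nd3; rewrite /chi /periodic /= /dvdn.
  by case: (j %% 3)%N (ltn_mod j 3) => [|[|[|]]].
have -> : tau j = 0.
  move: j nd3; apply: (@periodic_ind (fun j => ~~ (3 %| j)%N -> _) 9) => // [i IH|].
    by rewrite dvdn_addl // tauD.
  by do 9?[case=> //].
have x3 : (3 %| j%:Z ^+ 2 - 1)%Z.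
  have := chi2 j; have -> // : chi j = 1.
  move: nd3; rewrite /chi /periodic /= /dvdn.
  by case: (j %% 3)%N (ltn_mod j 3) => [|[|[|]]].
have := @expr1D_mod (j%:Z ^+ 2 - 1) n (dvdz_exp2r 3 x3).
rewrite (addrC 1) subrK -exprM; congr (_ %| _ - _)%Z; ring.
Qed.

Lemma eulerian_wsums n : (2 <= n)%N ->
  (27 %| eulerian (2 * n) n.+1 - (wsum n chi
     + n%:Z * (sqsum n - wsum n chi - 9 * wsum n tau)
     + 'C(n, 2)%:Z * (wsum n (fun j => j%:Z ^+ 4) - 2 * sqsum n + wsum n chi
                      + 18 * wsum n tau)))%Z.
Proof.
case: n => // n n_ge2; rewrite eulerian_wsum /sqsum.
set f := fun j : nat => j%:Z ^+ (2 * n.+1).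
(* Differences are written as sums with negative scalars, to match [wsumD] and [wsumZ]. *)
pose g j := chi j + n.+1%:Z * (j%:Z ^+ 2 + (- 1) * chi j + (- 9) * tau j)
     + 'C(n.+1, 2)%:Z * (j%:Z ^+ 4 + (- 2) * j%:Z ^+ 2 + chi j + 18 * tau j).
have : (27 %| wsum n.+1 (fun j => f j + (- 1) * g j))%Z.
  apply: dvd_wsum => i; rewrite mulN1r.
  by have := @pow_mod27 n.+1 i.+1 n_ge2; congr (_ %| _ - _)%Z; rewrite /g; ring.
by rewrite /g !(wsumD, wsumZ); congr (_ %| _)%Z; ring.
Qed.

Lemma eulerian_mod27 n :
  (27 %| eulerian (2 * n.+2) n.+3 - (sqsum n.+2 + 12 * cbin n))%Z.
Proof.
(* The general case uses the Catalan recurrence down to [sqsum n.-1], whose index must be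
   positive. *)
case: n => [|[|m]].
- by rewrite eulerian_wsum /sqsum /wsum !big_ord_recl !big_ord0; vm_compute.
- by rewrite eulerian_wsum /sqsum /wsum !big_ord_recl !big_ord0; vm_compute.
have := @eulerian_wsums m.+4 isT.
have /dvdzP[k Tk] := wsum_tau m.+1.
rewrite !wsum_chiS wsum_pow4 -(sqsum_cbin m.+2).
rewrite -[wsum m.+4 tau](subrK (sqsum m.+2 + sqsum m.+1)) Tk.
have := sqsumS_rec m.+1; have := sqsumS_rec m.
set s1 := sqsum m.+1; set s2 := sqsum m.+2; set s3 := sqsum m.+3.
set U := wsum _ chi; move: (sqsum m.+4) (eulerian _ _) => s4 e r2 r3.
have : 2 * 'C(m.+4, 2)%:Z = m.+4%:Z * m.+3%:Z.
  by have := mul_bin_diag m.+4 1; rewrite bin1 /= => /(congr1 Posz); rewrite !PoszM => <-.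
move: ('C(m.+4, 2)%:Z) => B B2 eE.
pose W := s1 - 3 * U.
(* Modulo 27 the discrepancy is 9X, so 3 must divide X. Doubling X clears the denominator of [B],
   and the Catalan recurrences then expose the factor 3. *)
pose X := - (m.+3%:Z * s3) + s2 - 2 * m.+4%:Z * s2 - m.+4%:Z * s1
  + B * (s3 + 3 * s2 + 2 * s1).
have : 2 * X = 3 * (m.+4%:Z * m.+3%:Z * s2 - 2 * s2
   + s1 * (6 * m%:Z ^+ 2 + 20 * m%:Z + 12)).
  transitivity (m.+2%:Z * (m.+3%:Z * s3) + (2 - 4 * m.+4%:Z) * s2
    + 3 * m.+4%:Z * m.+3%:Z * s2 + 2 * m.+4%:Z * m.+2%:Z * s1
    + (2 * B - m.+4%:Z * m.+3%:Z) * (s3 + 3 * s2 + 2 * s1)).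
    rewrite /X -!natz; ring.
  rewrite B2 subrr mul0r addr0 r3.
  transitivity (- (4 * m%:Z + 10) * (m.+2%:Z * s2) - 6 * s2
    + 3 * m.+4%:Z * m.+3%:Z * s2 + 2 * m.+4%:Z * m.+2%:Z * s1).
    rewrite -!natz; ring.
  rewrite r2 -!natz; ring.
move: (_ + s1 * _) => Z XZ.
suff -> : e - (s4 + 12 * (m.+3%:Z * s3)) =
    e - (s4 - 3 * (s3 - 3 * (s2 - 3 * W)) + m.+4%:Z *
         (s4 - (s4 - 3 * (s3 - 3 * (s2 - 3 * W))) - 9 * (k * 3 + (s2 + s1))) +
         B * (s4 + 12 * s3 - 2 * s4 + (s4 - 3 * (s3 - 3 * (s2 - 3 * W))) +
          18 * (k * 3 + (s2 + s1))))
    + (9 * X + 27 * (- W + m.+4%:Z * (W - k) + B * (2 * k - W))).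
  apply: rpredD; first exact: eE.
  apply: rpredD; last exact: dvdz_mulr.
  (* 2X = 3Z gives X = 3(X - Z). *)
  by apply/dvdzP; exists (X - Z); lia.
rewrite /X -!natz; ring.
Qed.

(** * The truncation of (1+4z)^(-1/2) *)

Definition cbin_poly (N : nat) : {poly int} := \poly_(i < N.+1) cbin i.

Lemma cbin_poly_deriv N : exists a : int,
  (1 + 4 * 'X) * (cbin_poly N)^`() = - 2 * cbin_poly N + a *: 'X^N.
Proof.
(* In degree N truncation removes the term with [cbin N.+1]; [a] is the resulting defect. *)
exists (4 * N%:Z * cbin N + 2 * cbin N); apply/polyP => i.
rewrite coefD coefZ coefXn mulrDl mul1r -mulrA mulNr !mulr_natl coefD coefN !coefMn.
rewrite coefXM !coef_deriv !coef_poly -!natz !ltnS.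
have [ltiN|ltNi|->] := ltngtP i N.
- have := cbin_rec i; rewrite -!natz mulr_natl mulr0 addr0 => ->.
  case: i ltiN => [|i] ltiN /=; first by ring.
  rewrite (ltnW ltiN); ring.
- rewrite mulr0; case: i ltNi => // i ltNi /=.
  have -> : (i < N)%N = false by lia.
  ring.
- rewrite mulr1; case: N => [|N] /=; first by ring.
  rewrite leqnn; ring.
Qed.

(** By the differential equation, the derivative of the left side is a multiple of X^N, so degrees 1
    to N vanish. *)
Lemma cbin_poly_sq N : exists t, (1 + 4 * 'X) * cbin_poly N ^+ 2 = 1 + 'X^(N.+1) * t.
Proof.
have [a Da] := cbin_poly_deriv N; set D := cbin_poly N in Da *.
set G := _ * _; have dG : G^`() = 'X^N * (2 * D * a%:P).
  have de : (1 + 4 * 'X : {poly int})^`() = 4.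
    by rewrite mulr_natl derivD derivMn derivX -polyC1 derivC add0r.
  transitivity (4 * D ^+ 2 + 2 * D * ((1 + 4 * 'X) * D^`())).
    rewrite /G expr2 !derivM de; ring.
  rewrite Da -mul_polyC; ring.
exists (drop_poly N.+1 G); rewrite -{1}(poly_take_drop N.+1 G) mulrC addrC.
rewrite [in RHS]addrC mulrC; congr (_ * _ + _).
apply/polyP => i; rewrite coef_take_poly coef1; case: ifP => ltiN.
  case: i ltiN => [_|i ltiN] /=.
    by rewrite /G expr2 !coef0M coefD coef1 mulr_natl coefMn coefX coef_poly.
  have /eqP : G^`()`_i = 0 by rewrite dG coefXnM -ltnS ltiN.
  by rewrite coef_deriv Num.Theory.mulrn_eq0 /= => /eqP.
by case: i ltiN.
Qed.

(** * Psi modulo 3 *)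

Lemma F3_intr_eq0 (x : int) : (x%:~R == 0 :> 'F_3) = (3 %| x)%Z.
Proof. by rewrite (dvdz_pcharf (pchar_Fp (isT : prime 3))). Qed.

(** By Frobenius each factor is a power of 1 + X, and 1 + 2(1 + 3 + ... + 3^N) = 3^(N+1). *)
Lemma Psi_trunc_sq_F3 N :
  (1 + 'X) * map_poly intr (Psi_trunc N) ^+ 2 = 1 + 'X^(3 ^ N.+1) :> {poly 'F_3}.
Proof.
have ch3 : [pchar {poly 'F_3}].-nat 3%N.
  by rewrite pnatE // pchar_poly; exact: pchar_Fp.
have frob k : (1 + 'X : {poly 'F_3}) ^+ (3 ^ k) = 1 + 'X^(3 ^ k).
  by rewrite exprDn_pchar ?pnatX ?ch3 // expr1n.
rewrite -frob /Psi_trunc rmorph_prod.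
under eq_bigr => i _ do rewrite rmorphD rmorph1 /= map_polyXn -frob.
elim: N => [|N IHN]; first by rewrite big_ord1 expn0 expn1; ring.
rewrite big_ord_recr /= exprMn mulrA IHN -!exprM -!exprD; congr (_ ^+ _).
by rewrite !expnS; lia.
Qed.

(** Over F_3, where 4 = 1, X^(N+1) divides (1+X)(P+D)(P-D). The first two factors have constant term
    2, which is nonzero, so it divides P - D. *)
Lemma Psi_trunc_cbin_poly N : exists u v,
  Psi_trunc N = cbin_poly N + 3 * u + 'X^(N.+1) * v.
Proof.
set P := Psi_trunc N; set D := cbin_poly N.
pose f := map_poly (intr : int -> 'F_3).
have fP := Psi_trunc_sq_F3 N; rewrite -/P -/f in fP.
have [t fD] := cbin_poly_sq N; move/(congr1 f): fD; rewrite -/D.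
rewrite /f rmorphM rmorphXn rmorphD rmorph1 (rmorphM _ 4) rmorph_nat.
rewrite rmorphD rmorph1 rmorphM /= map_polyX map_polyXn -/f.
rewrite (_ : 4%:R = 1 :> {poly 'F_3}); last first.
  by rewrite -polyC1 -polyC_natr; congr (_%:P); apply/eqP.
rewrite mul1r => fD.
have : 'X^(N.+1) %| (1 + 'X) * (f P + f D) * (f P - f D).
  have le3 : (N.+1 <= 3 ^ N.+1)%N by apply/ltnW/ltn_expl.
  have -> : (1 + 'X) * (f P + f D) * (f P - f D)
      = (1 + 'X) * f P ^+ 2 - (1 + 'X) * f D ^+ 2 by ring.
  rewrite fP fD -(subnK le3) exprD; apply/dvdpP.
  by exists ('X^(3 ^ N.+1 - N.+1) - f t); ring.
have coef0P : P`_0 = 1.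
  rewrite /P /Psi_trunc -horner_coef0 horner_prod big1 // => i _.
  by rewrite !hornerE expr0n expn_eq0.
have coef0D : D`_0 = 1 by rewrite coef_poly.
rewrite Gauss_dvdpr; last first.
  apply: coprimep_expl; rewrite coprimep_sym coprimepX rootM !rootE !hornerE.
  rewrite !horner_coef0 !coef_map /= coef0P coef0D; exact/eqP.
move=> /dvdpP[w fw].
have dvd3 i : (i < N.+1)%N -> (3 %| (P - D)`_i)%Z.
  move=> ltiN; rewrite -F3_intr_eq0 -(coef_map (intr : int -> 'F_3)) -/f.
  by rewrite /f rmorphB /= -/f fw coefMXn ltiN.
pose u : {poly int} := \poly_(i < N.+1) ((P - D)`_i %/ 3)%Z.
exists u, (drop_poly N.+1 (P - D)).
rewrite -[LHS](subrKC D) -addrA; congr (_ + _).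
rewrite -[LHS](poly_take_drop N.+1) [_ * 'X^_]mulrC; congr (_ + _).
apply/polyP => i; rewrite coef_take_poly mulr_natl coefMn coef_poly.
by case: ifP => // /dvd3 /divzK {1}<-; ring.
Qed.

(** * Reduction of the right-hand side and conclusion *)

Lemma quintic_reduction (R : comRingType) (z D u v M t : R) :
  (1 + 4 * z) * D ^+ 2 = 1 + M * t ->
  let P := D + 3 * u + M * v in
  exists k l, 14 + 3 * (3 * z ^+ 2 - 4 * z + 2) * P
    + (21 * z ^+ 3 + 20 * z ^+ 2 + 13 * z + 23) * P ^+ 3
    + 3 * (6 * z ^+ 4 + 4 * z ^+ 3 + 3 * z ^+ 2 + 4) * P ^+ 5
  = 14 + (14 * (1 + 4 * z) + 12 * z ^+ 2) * D + 27 * k + M * l.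
Proof.
move=> eD P.
pose e := 1 + 4 * z; pose Q := D + 3 * u.
pose a := 3 * z ^+ 2 - 4 * z + 2.
pose b := 21 * z ^+ 3 + 20 * z ^+ 2 + 13 * z + 23.
pose c := 6 * z ^+ 4 + 4 * z ^+ 3 + 3 * z ^+ 2 + 4.
(* Quotients in a e^2 + b e + 5c = 3g and 3a e^2 + b e + 3c = (14e + 12z^2) e^2 + 27h. *)
pose g := 15 + 39 * z + 30 * z ^+ 2 + 27 * z ^+ 3 + 54 * z ^+ 4.
pose h := 1 - z - 22 * z ^+ 2 - 37 * z ^+ 3 + 2 * z ^+ 4.
rewrite -/a -/b -/c -/e in eD *.
have eD2 : e ^+ 2 * D ^+ 4 = 1 + M * (2 * t + M * t ^+ 2).
  transitivity ((e * D ^+ 2) ^+ 2); [ring | rewrite eD; ring].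
move: (2 * t + M * t ^+ 2) eD2 => t2 eD2.
have Q1 : P = Q + M * v by [].
have [l3 Q3] : exists l, P ^+ 3 = Q ^+ 3 + M * l.
  exists (v * (P ^+ 2 + P * Q + Q ^+ 2)); rewrite Q1; ring.
have [l5 Q5] : exists l, P ^+ 5 = Q ^+ 5 + M * l.
  exists (v * (P ^+ 4 + P ^+ 3 * Q + P ^+ 2 * Q ^+ 2 + P * Q ^+ 3 + Q ^+ 4)).
  rewrite Q1; ring.
have low : a + b * D ^+ 2 + 5 * c * D ^+ 4
    = 3 * (D ^+ 4 * g) - M * (t2 * a + t * b * D ^+ 2).
  transitivity (D ^+ 4 * (a * e ^+ 2 + b * e + 5 * c)
    + a * (1 - e ^+ 2 * D ^+ 4) + b * D ^+ 2 * (1 - e * D ^+ 2)); first by ring.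
  by rewrite eD eD2 /a /b /c /e /g; ring.
have top : 3 * a * D + b * D ^+ 3 + 3 * c * D ^+ 5
    = (14 * e + 12 * z ^+ 2) * D * (1 + M * t2) + 27 * (D ^+ 5 * h)
      - M * (t2 * (3 * a * D) + t * b * D ^+ 3).
  transitivity ((14 * e + 12 * z ^+ 2) * D * (e ^+ 2 * D ^+ 4)
    + 27 * (D ^+ 5 * h) + 3 * a * D * (1 - e ^+ 2 * D ^+ 4)
    + b * D ^+ 3 * (1 - e * D ^+ 2)); first by rewrite /a /b /c /e /h; ring.
  rewrite eD eD2; ring.
(* Besides [h] and [g], this holds the terms of degree at least 2 in [u]; the second witness gathers
   the multiples of [M], which stands for X^(N+1). *)
exists (D ^+ 5 * h + u * D ^+ 4 * g + b * (D * u ^+ 2 + u ^+ 3)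
  + c * (10 * D ^+ 3 * u ^+ 2 + 30 * D ^+ 2 * u ^+ 3 + 45 * D * u ^+ 4 + 27 * u ^+ 5)).
exists ((14 * e + 12 * z ^+ 2) * D * t2 - (t2 * (3 * a * D) + t * b * D ^+ 3)
  - 9 * u * (t2 * a + t * b * D ^+ 2) + 3 * a * v + b * l3 + 3 * c * l5).
rewrite Q1 Q3 Q5.
transitivity (14 + (3 * a * D + b * D ^+ 3 + 3 * c * D ^+ 5)
  + 9 * u * (a + b * D ^+ 2 + 5 * c * D ^+ 4)
  + 27 * (b * (D * u ^+ 2 + u ^+ 3)
  + c * (10 * D ^+ 3 * u ^+ 2 + 30 * D ^+ 2 * u ^+ 3 + 45 * D * u ^+ 4 + 27 * u ^+ 5))
  + M * (3 * a * v + b * l3 + 3 * c * l5)).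
  rewrite /Q; ring.
rewrite low top; ring.
Qed.

Lemma rhs_trunc_mod27 n :
  (27 %| (rhs_trunc n)`_n
     - (14 + (14 * (1 + 4 * 'X) + 12 * 'X^2) * cbin_poly n : {poly int})`_n)%Z.
Proof.
have [u [v eP]] := Psi_trunc_cbin_poly n; have [t eD] := cbin_poly_sq n.
have [k [l e]] := quintic_reduction u v eD.
have -> : rhs_trunc n = 14 + 3 * (3 * 'X^2 - 4 * 'X + 2) * Psi_trunc n
    + (21 * 'X^3 + 20 * 'X^2 + 13 * 'X + 23) * Psi_trunc n ^+ 3
    + 3 * (6 * 'X^4 + 4 * 'X^3 + 3 * 'X^2 + 4) * Psi_trunc n ^+ 5.
  by rewrite /rhs_trunc !polyC_natr.
have subK (p q r : {poly int}) : p + q + r - p = q + r by ring.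
rewrite eP e -coefB subK mulr_natl coefD coefMn coefXnM ltnSn.
by apply/dvdzP; exists k`_n; ring.
Qed.

Theorem theorem18p7 (n : nat) :
  (27 %| eulerian (2 * n) n.+1 - (rhs_trunc n)`_n)%Z.
Proof.
have := rhs_trunc_mod27 n.
have -> : (14 + (14 * (1 + 4 * 'X) + 12 * 'X^2) * cbin_poly n : {poly int})
  = 14%:P + 14 *: cbin_poly n + 56 *: ('X * cbin_poly n)
    + 12 *: ('X^2 * cbin_poly n).
  by rewrite -!mul_polyC !polyC_natr; ring.
move: (rhs_trunc n)`_n => x.
rewrite !coefD !coefZ coefC coefXM coefXnM !coef_poly.
(* In degrees 0 and 1 the reduced coefficient is 28, and A(0,1) = A(2,2) = 1. *)
case: n => [|[|n]] /dvdzP[q eq]; apply/dvdzP.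
- have -> : eulerian (2 * 0) 1 = 1 by [].
  move: eq; rewrite /= (_ : cbin 0 = 1) // => eq.
  by exists (- q - 1); lia.
- have -> : eulerian (2 * 1) 2 = 1.
    by rewrite eulerian_wsum /wsum !big_ord_recl !big_ord0; vm_compute.
  move: eq; rewrite /= (_ : cbin 0 = 1) // (_ : cbin 1 = - 2) // => eq.
  by exists (- q - 1); lia.
rewrite /= subn2 /= !ltnS leqnn leqnSn ltnW // add0r in eq.
have /dvdzP[r er] := eulerian_mod27 n; have es := double_sqsumS n.+1.
(* By [es], 14 [cbin n.+2] + 56 [cbin n.+1] = 28 [sqsum n.+2], which exceeds [sqsum n.+2] by 27
   [sqsum n.+2]. *)
exists (r - q - sqsum n.+2). lia.
Qed.
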